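(* Consider a network setting of $n$ firms with all edges allowed. Suppose $\Sigma_i=\Sigma$ for all firms, and let $M$ be the matrix of expected returns. 1. (Change in beliefs about expected returns) Let $\Sigma$ have the eigendecomposition $\Sigma=V\Lambda V^T$. Then for $i,j,k,\ell\in[n]$, $$\frac{\partial W_{ij}}{\partial M_{k\ell}}=\frac{1}{2\sqrt{\gamma_i\gamma_j\gamma_k\gamma_\ell}}\sum_{s,t\in[n]}\frac{V_{is}V_{ks}V_{jt}V_{\ell t}+V_{is}V_{\ell s}V_{jt}V_{kt}}{\lambda_s+\lambda_t}.$$ In particular, $W_{ij}$ is monotonically increasing with respect to $M_{ij}$. 2. (Risk scaling) If the covariance $\Sigma$ changes to $c\Sigma$ ($c>0$), then $W$ changes to $(1/c)W$. 3. (Increase in perceived risk) Suppose $\gamma_i=\gamma$ for all $i$, and the covariance $\Sigma$ increases to $\Sigma'\succ\Sigma$. Let $W$ and $W'$ be the stable points under $\Sigma$ and $\Sigma'$ respectively. Then $\mathrm{tr}(M^T(W'-W))<0$.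
   Context: $[n]=\{1,\dots,n\}$; $\mathbf e_1,\dots,\mathbf e_n$ is the standard basis of $\mathbb R^n$; $A\succ B$ means $A-B$ is positive definite. There are $n$ firms; firm $i$ has a vector of expected returns $\boldsymbol\mu_i\in\mathbb R^n$, a covariance matrix $\Sigma_i\succ0$, and a risk aversion $\gamma_i>0$. $M\in\mathbb R^{n\times n}$ has $i$-th column $\boldsymbol\mu_i$. In the eigendecomposition, $V$ is orthogonal with entries $V_{is}$ and $\Lambda=\mathrm{diag}(\lambda_1,\dots,\lambda_n)$. A pair $(W,P)$ of real $n\times n$ matrices (contract sizes and prices) is feasible, all edges being allowed, if $W=W^T$ and $P=-P^T$. With $\mathbf w_i$ the $i$-th column of $W$, firm $i$'s utility is $g_i(W,P)=\mathbf w_i^T(\boldsymbol\mu_i-P\mathbf e_i)-\gamma_i\,\mathbf w_i^T\Sigma_i\mathbf w_i$. A feasible $(W,P)$ is a stable point if for every $i\in[n]$, $g_i(W,P)$ equals the maximum of $g_i(W',P)$ over all $W'$ with $(W',P)$ feasible. When all firms share the same covariance $\Sigma$ and all edges are allowed, the stable point exists and is unique; $W$ denotes its contract-size matrix (the stable network), and likewise $W'$ in part 3.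
   Formalization: Part 1 takes VΛVᵀ as the eigendecomposition of Γ^(-1/2)ΣΓ^(-1/2), Γ=diag(γ_i), since with Σ itself it fails (n=1, Σ=1, γ=2: derivative 1/4, formula 1/8). Part 3 assumes M+Mᵀ≠0, since otherwise W=W'=0 and the trace is 0. *)

(* Defs.v *)
From mathcomp Require Import all_boot all_order all_algebra.
From mathcomp Require Import all_classical all_reals all_analysis.

Set Implicit Arguments.
Unset Strict Implicit.
Unset Printing Implicit Defensive.

Import Order.TTheory GRing.Theory Num.Theory.
Import numFieldNormedType.Exports.

Local Open Scope ring_scope.

Definition posdef (R : realType) (n : nat) (A : 'M[R]_n) : Prop :=
  A^T = A /\ forall x : 'cV[R]_n, x != 0 -> 0 < (x^T *m A *m x) 0 0.

Definition feasible (R : realType) (n : nat) (W P : 'M[R]_n) : Prop :=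
  W^T = W /\ P^T = - P.

(* Firm [i] has expected returns [col i M], covariance [Sigma i] and risk
   aversion [gamma i]; the column vector [delta_mx i 0] is e_i. *)
Definition utility (R : realType) (n : nat) (gamma : 'I_n -> R)
    (Sigma : 'I_n -> 'M[R]_n) (M W P : 'M[R]_n) (i : 'I_n) : R :=
  ((col i W)^T *m (col i M - P *m delta_mx i 0)) 0 0
  - gamma i * ((col i W)^T *m Sigma i *m col i W) 0 0.

(* As [W] itself competes in the comparison, this says that the maximum over
   the [W'] feasible with [P] is attained at [W]. *)
Definition stable_point (R : realType) (n : nat) (gamma : 'I_n -> R)
    (Sigma : 'I_n -> 'M[R]_n) (M W P : 'M[R]_n) : Prop :=
  feasible W P /\
  forall (i : 'I_n) (W' : 'M[R]_n), feasible W' P ->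
    utility gamma Sigma M W' P i <= utility gamma Sigma M W P i.

(* The contract sizes of the stable point. The default value 0 is never used
   when the [gamma i] are positive and all [Sigma i] are the same positive
   definite matrix: the stable point then exists and is unique. *)
Definition stable_network (R : realType) (n : nat) (gamma : 'I_n -> R)
    (Sigma : 'I_n -> 'M[R]_n) (M : 'M[R]_n) : 'M[R]_n :=
  xget 0 [set W | exists P, stable_point gamma Sigma M W P]%classic.

(* Gamma^(-1/2) Sigma Gamma^(-1/2), where Gamma = diag(gamma_1, ..., gamma_n).
   Adding the first-order conditions M - P = 2 Sigma W Gamma to their transpose
   gives M + M^T = 2 (Sigma W Gamma + Gamma W Sigma). For A this matrix and
   X := Gamma^(1/2) W Gamma^(1/2), this is the Sylvester equation
     A X + X A = Gamma^(-1/2) (M + M^T) Gamma^(-1/2) / 2,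
   which an eigendecomposition of A solves. An eigendecomposition of Sigma
   would not do: for n = 1, Sigma = 1, gamma = 2 one has W = M / 4, whereas the
   sensitivity formula with lambda = 1 gives the derivative 1/8. *)
Definition normalized_cov (R : realType) (n : nat) (gamma : 'I_n -> R)
    (Sigma : 'M[R]_n) : 'M[R]_n :=
  let D := diag_mx (\row_i (Num.sqrt (gamma i))^-1) in D *m Sigma *m D.

Definition eigendecomposition (R : realType) (n : nat) (A V : 'M[R]_n)
    (lambda : 'rV[R]_n) : Prop :=
  V^T *m V = 1%:M /\ A = V *m diag_mx lambda *m V^T.

(* Main.v *)
(* Writing G for the diagonal matrix of risk aversions, the first-order
   conditions M - P = 2 S W G say that a symmetric W is a stable network iff
     S W G + G W S = (M + M^T) / 2.
   The operator L on the left is self-adjoint for <X, Y> = tr (X^T Y), and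
   <L W, W> is a sum of terms gamma_i x^T S x with x ranging over the columns of
   W and of W^T. So L is positive definite, hence bijective, and W depends
   linearly on M: its directional derivatives are its values, and those at
   delta_mx k l are computed by diagonalizing the equation. Monotonicity and the
   trace inequality only use the positivity of L. *)
Require Import Defs.
From HB Require Import structures.
From mathcomp Require Import all_boot all_order all_algebra.
From mathcomp Require Import all_classical all_reals all_analysis.
From mathcomp Require Import ring lra.

Set Implicit Arguments.
Unset Strict Implicit.
Unset Printing Implicit Defensive.

Import Order.TTheory GRing.Theory Num.Theory.
Import numFieldNormedType.Exports.

Local Open Scope ring_scope.

(** * The Sylvester operator and its positivity *)

Definition sylvester (R : realType) (n : nat) (gamma : 'I_n -> R)
    (S W : 'M[R]_n) : 'M[R]_n :=
  let G := diag_mx (\row_i gamma i) in S *m W *m G + G *m W *m S.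

Lemma posdef_form_ge0 (R : realType) (n : nat) (S : 'M[R]_n) (x : 'cV[R]_n) :
  posdef S -> 0 <= (x^T *m S *m x) 0 0.
Proof.
move=> [_ S_gt0]; have [->|/S_gt0/ltW//] := eqVneq x 0.
by rewrite mulmx0 mxE.
Qed.

Lemma form_col (R : realType) (n : nat) (S X : 'M[R]_n) (i : 'I_n) :
  ((col i X)^T *m S *m col i X) 0 0 = (X^T *m S *m X) i i.
Proof.
by rewrite tr_col -row_mul !mxE; apply: eq_bigr => j _; rewrite !mxE.
Qed.

Lemma trace_sylvester (R : realType) (n : nat) (gamma : 'I_n -> R)
    (S W : 'M[R]_n) :
  \tr (W^T *m sylvester gamma S W) =
  \sum_i gamma i * ((col i W)^T *m S *m col i W) 0 0
  + \sum_i gamma i * ((col i W^T)^T *m S *m col i W^T) 0 0.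
Proof.
have trG (X : 'M[R]_n) : \tr (X^T *m (S *m X *m diag_mx (\row_i gamma i)))
    = \sum_i gamma i * ((col i X)^T *m S *m col i X) 0 0.
  rewrite !mulmxA mxtrace_mulC mul_diag_mx; apply: eq_bigr => i _.
  by rewrite mxE mxE form_col.
rewrite /sylvester mulmxDr mxtraceD trG -(trG W^T) trmxK; congr (_ + _).
(* Cyclicity turns tr (W^T G W S) into tr (W S W^T G), which is the first sum taken at [W^T]. *)
by rewrite 2!mulmxA [LHS]mxtrace_mulC !mulmxA mxtrace_mulC !mulmxA.
Qed.

Lemma tr_sylvester (R : realType) (n : nat) (gamma : 'I_n -> R)
    (S W : 'M[R]_n) : S^T = S ->
  (sylvester gamma S W)^T = sylvester gamma S W^T.
Proof.
move=> S_sym; rewrite /sylvester linearD /= !trmx_mul S_sym tr_diag_mx.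
by rewrite addrC !mulmxA.
Qed.

Lemma trace_sylvesterC (R : realType) (n : nat) (gamma : 'I_n -> R)
    (S X Y : 'M[R]_n) : S^T = S ->
  \tr (X^T *m sylvester gamma S Y) = \tr (Y^T *m sylvester gamma S X).
Proof.
move=> S_sym; rewrite -[LHS]mxtrace_tr trmx_mul trmxK tr_sylvester//.
rewrite /sylvester mulmxDl mulmxDr !mxtraceD [LHS]addrC.
congr (_ + _); first by rewrite -!mulmxA [LHS]mxtrace_mulC -!mulmxA.
by rewrite -!mulmxA [LHS]mxtrace_mulC -!mulmxA.
Qed.

Lemma trace_sylvester_gt0 (R : realType) (n : nat) (gamma : 'I_n -> R)
    (S W : 'M[R]_n) : (forall i, 0 < gamma i) -> posdef S -> W != 0 ->
  0 < \tr (W^T *m sylvester gamma S W).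
Proof.
move=> gamma_gt0 S_posdef W_neq0.
have term_ge0 (X : 'M[R]_n) i :
    0 <= gamma i * ((col i X)^T *m S *m col i X) 0 0.
  by rewrite mulr_ge0 ?posdef_form_ge0// ltW.
(* One nonzero column of [W] makes the first sum positive; the second only has to be nonnegative. *)
have [i colW] : exists i, col i W != 0.
  apply/existsP; apply: contraNT W_neq0 => /existsPn col0.
  apply/eqP/matrixP => a b; have /eqP/matrixP/(_ a 0) := negbNE (col0 b).
  by rewrite !mxE.
rewrite trace_sylvester ltr_wpDr ?sumr_ge0// (bigD1 i)//= ltr_wpDr ?sumr_ge0//.
by rewrite mulr_gt0 //; apply S_posdef.2.
Qed.

Lemma sylvester_is_linear (R : realType) (n : nat) (gamma : 'I_n -> R)
    (S : 'M[R]_n) : linear (sylvester gamma S).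
Proof.
move=> a X Y; rewrite /sylvester !(mulmxDr, mulmxDl) -!(scalemxAl, scalemxAr).
by rewrite scalerDr addrACA.
Qed.

HB.instance Definition _ (R : realType) (n : nat) (gamma : 'I_n -> R)
    (S : 'M[R]_n) :=
  GRing.isLinear.Build R 'M[R]_n 'M[R]_n _ (sylvester gamma S)
    (sylvester_is_linear gamma S).

Lemma sylvester_inj (R : realType) (n : nat) (gamma : 'I_n -> R)
    (S : 'M[R]_n) : (forall i, 0 < gamma i) -> posdef S ->
  injective (sylvester gamma S).
Proof.
move=> gamma_gt0 S_posdef; apply: raddf_inj => W W0; apply/eqP.
apply: contraTT (lexx (0 : R)) => W_neq0; rewrite -ltNge.
have := trace_sylvester_gt0 gamma_gt0 S_posdef W_neq0.
by rewrite W0 mulmx0 mxtrace0.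
Qed.

(** An injective endomorphism of a finite-dimensional space is onto: the matrix [lin_mx] of the
    operator has trivial kernel, hence is invertible. *)
Lemma sylvester_surj (R : realType) (n : nat) (gamma : 'I_n -> R)
    (S B : 'M[R]_n) : (forall i, 0 < gamma i) -> posdef S ->
  exists W, sylvester gamma S W = B.
Proof.
move=> gamma_gt0 S_posdef; pose L := lin_mx (sylvester gamma S).
have L_unit : L \in unitmx.
  rewrite -row_free_unit -kermx_eq0; apply/rowV0P => v /sub_kermxP.
  rewrite -[v]vec_mxK mul_vec_lin => /eqP; rewrite mxvec_eq0 => /eqP W0.
  suff -> : vec_mx v = 0 by rewrite linear0.
  by apply: (sylvester_inj gamma_gt0 S_posdef); rewrite W0 linear0.
exists (vec_mx (mxvec B *m invmx L)).
by apply: (can_inj mxvecK); rewrite -mul_vec_lin vec_mxK mulmxKV.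
Qed.

(** * First-order conditions for stable points *)

Lemma form_add (R : realType) (n : nat) (S : 'M[R]_n) (x d b : 'cV[R]_n)
    (g : R) : S^T = S ->
  ((x + d)^T *m b) 0 0 - g * ((x + d)^T *m S *m (x + d)) 0 0 =
  (x^T *m b) 0 0 - g * (x^T *m S *m x) 0 0
  + (d^T *m (b - (2 * g) *: (S *m x))) 0 0 - g * (d^T *m S *m d) 0 0.
Proof.
move=> S_sym.
have cross : (x^T *m S *m d) 0 0 = (d^T *m S *m x) 0 0.
  by rewrite -[LHS]trace_mx11 -mxtrace_tr !trmx_mul trmxK S_sym trace_mx11
    mulmxA.
rewrite linearD /= !mulmxDl !mulmxDr mulmxN -scalemxAr mulmxA.
have E (A B : 'M[R]_1) : (A + B) 0 0 = A 0 0 + B 0 0 by rewrite mxE.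
have EN (A : 'M[R]_1) : (- A) 0 0 = - A 0 0 by rewrite mxE.
have EZ a (A : 'M[R]_1) : (a *: A) 0 0 = a * A 0 0 by rewrite mxE.
rewrite !(E, EN, EZ) cross; ring.
Qed.

(** The utility of firm [i] sees only column [i], so symmetry of the contracts does not restrict the
    deviations of a single firm. *)
Lemma sym_with_col (R : realType) (n : nat) (i : 'I_n) (w : 'cV[R]_n) :
  exists2 W : 'M[R]_n, W^T = W & col i W = w.
Proof.
exists (\matrix_(a, b) if a == i then w b 0 else if b == i then w a 0 else 0).
  apply/matrixP => a b; rewrite !mxE.
  by case: (eqVneq a i) => [->|_]; case: (eqVneq b i) => [?|_]; subst.
by apply/colP => a; rewrite !mxE eqxx; case: eqP => [->|].
Qed.

(** By [form_add], the utility of firm [i] is a concave quadratic in its column w_i, with gradient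
    (M - P) e_i - 2 gamma_i S w_i. It is maximal exactly where this gradient vanishes, and the
    matrix equation collects these conditions column by column. *)
Lemma stable_pointP (R : realType) (n : nat) (gamma : 'I_n -> R)
    (S M W P : 'M[R]_n) : (forall i, 0 < gamma i) -> posdef S ->
  stable_point gamma (fun=> S) M W P <->
  feasible W P /\ M - P = 2 *: (S *m W *m diag_mx (\row_i gamma i)).
Proof.
move=> gamma_gt0 S_posdef; have [S_sym S_gt0] := S_posdef.
have colE' i : col i (2 *: (S *m W *m diag_mx (\row_i gamma i)))
    = (2 * gamma i) *: (S *m col i W).
  apply/colP => a; rewrite mul_mx_diag !mxE -mulrA; congr (_ * _).
  rewrite mulrC; congr (_ * _).
  by apply: eq_bigr => j _; rewrite mxE.
split=> -[W_feas max]; split=> //.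
  apply/matrixP => a i; suff : col i (M - P) = (2 * gamma i) *: (S *m col i W).
    by rewrite -colE' => /colP/(_ a); rewrite !mxE.
  set c := RHS; rewrite linearB /= [col i P]colE; set b := _ - _.
  apply/eqP; rewrite -subr_eq0; set r := b - c; apply/negPn/negP => r_neq0.
  have r2_gt0 : 0 < (r^T *m r) 0 0.
    have [j rj] : exists j, r j 0 != 0.
      apply/existsP; apply: contraNT r_neq0 => /existsPn r0.
      by apply/eqP/colP => a'; rewrite [RHS]mxE; apply/eqP/negbNE/r0.
    rewrite mxE (bigD1 j)//= ltr_wpDr//.
      by apply: sumr_ge0 => k _; rewrite mxE -expr2 sqr_ge0.
    by rewrite mxE -expr2 exprn_even_gt0.
  have rSr_gt0 := S_gt0 _ r_neq0; have gi_gt0 := gamma_gt0 i.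
  set p := (r^T *m r) 0 0 in r2_gt0; set q := (r^T *m S *m r) 0 0 in rSr_gt0.
  (* Moving by [t] along the gradient [r] gains t p - gamma_i t^2 q. This [t] maximizes the gain,
     which is then p^2 / (4 gamma_i q) > 0. *)
  pose t := p / (2 * gamma i * q).
  have [W' W'_sym colW'] := sym_with_col i (col i W + t *: r).
  have := max i W' (conj W'_sym W_feas.2).
  rewrite /utility colW' -/b form_add // -/c -/r.
  rewrite [(t *: r)^T]linearZ /= -!scalemxAl -scalemxAr.
  have EZ a' (A : 'M[R]_1) : (a' *: A) 0 0 = a' * A 0 0 by rewrite mxE.
  rewrite !EZ -/p -/q -addrA gerDl leNgt => /negP; apply.
  have -> : t * p - gamma i * (t * (t * q)) = p ^+ 2 / (4 * gamma i * q).
    by rewrite /t; field; rewrite !gt_eqF.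
  by rewrite divr_gt0 ?exprn_gt0 ?mulr_gt0.
move=> i W' W'_feas; rewrite /utility; set d := col i W' - col i W.
have -> : col i W' = col i W + d by rewrite addrC subrK.
(* The linear term in [d] vanishes by the first-order condition, leaving - gamma_i d^T S d. *)
rewrite form_add // -colE -linearB /= max colE' subrr mulmx0.
by rewrite [in X in _ + X - _]mxE addr0 gerBl mulr_ge0 ?posdef_form_ge0// ltW.
Qed.

(** Eliminates the prices: the skew [P] cancels when the first-order condition is added to its
    transpose, and it can be recovered from a solution. Symmetry of [W] is a consequence of the
    equation. *)
Lemma stable_networkP (R : realType) (n : nat) (gamma : 'I_n -> R)
    (S M W : 'M[R]_n) : (forall i, 0 < gamma i) -> posdef S ->
  stable_network gamma (fun=> S) M = W <->
  sylvester gamma S W = 2^-1 *: (M + M^T).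
Proof.
move=> gamma_gt0 S_posdef; have S_sym := S_posdef.1.
have spec X : (exists P, stable_point gamma (fun=> S) M X P) <->
    sylvester gamma S X = 2^-1 *: (M + M^T).
  set G := diag_mx (\row_i gamma i).
  have twice_inj (A B : 'M[R]_n) : 2 *: A = B <-> A = 2^-1 *: B.
    by split=> [<-|->]; rewrite scalerA ?(mulVf, mulfV) ?scale1r ?pnatr_eq0.
  have trFOC : X^T = X -> (S *m X *m G)^T = G *m X *m S.
    by move=> X_sym; rewrite !trmx_mul X_sym S_sym tr_diag_mx mulmxA.
  split=> [[P /(stable_pointP _ _ _ gamma_gt0 S_posdef)]|X_eq].
    move=> [[X_sym P_skew] FOC].
    rewrite -/G in FOC.
    have := congr1 trmx FOC.
    rewrite linearB linearZ /= trFOC// P_skew opprK => FOCt.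
    apply/twice_inj; rewrite /sylvester -/G scalerDr -FOC -FOCt.
    by rewrite addrACA addNr addr0.
  (* The right-hand side is symmetric, so [X^T] solves the same equation as [X]. *)
  have X_sym : X^T = X.
    apply: (sylvester_inj gamma_gt0 S_posdef).
    by rewrite -tr_sylvester// X_eq linearZ /= linearD /= trmxK addrC.
  (* The only prices that the first-order conditions allow; the Sylvester equation says that they
     are skew. *)
  exists (M - 2 *: (S *m X *m G)).
  apply/(stable_pointP _ _ _ gamma_gt0 S_posdef); split; last first.
    by rewrite opprB addrC subrK.
  split=> //; rewrite linearB /= linearZ /= trFOC//.
  move/twice_inj: X_eq; rewrite /sylvester -/G scalerDr => E.
  by rewrite opprB; apply/eqP; rewrite subr_eq addrAC E addrAC subrr add0r.
have [X X_eq] := sylvester_surj (2^-1 *: (M + M^T)) gamma_gt0 S_posdef.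
(* Since a solution exists, [xget] does not return its default, and the network itself solves the
   equation; injectivity then identifies it with any other solution. *)
have /spec net_eq : exists P,
    stable_point gamma (fun=> S) M (stable_network gamma (fun=> S) M) P.
  apply: (@xgetPex _ 0 [set W | exists P, stable_point _ _ _ W P]%classic).
  by exists X; apply/spec.
split=> [<-//|W_eq]; apply: (sylvester_inj gamma_gt0 S_posdef).
by rewrite W_eq.
Qed.


(** * Linearity and positivity in the expected returns *)

Lemma stable_network_is_linear (R : realType) (n : nat) (gamma : 'I_n -> R)
    (S : 'M[R]_n) : (forall i, 0 < gamma i) -> posdef S ->
  linear (stable_network gamma (fun=> S)).
Proof.
move=> gamma_gt0 S_posdef a M N; apply/stable_networkP => //.
have netE X : sylvester gamma S (stable_network gamma (fun=> S) X)
    = 2^-1 *: (X + X^T) by apply/stable_networkP.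
rewrite linearP /= !netE scalerA mulrC -scalerA -scalerDr; congr (_ *: _).
by rewrite linearP /= scalerDr addrACA.
Qed.

Lemma stable_network_sym (R : realType) (n : nat) (gamma : 'I_n -> R)
    (S M : 'M[R]_n) : (forall i, 0 < gamma i) -> posdef S ->
  (stable_network gamma (fun=> S) M)^T = stable_network gamma (fun=> S) M.
Proof.
move=> gamma_gt0 S_posdef; apply/esym/stable_networkP => //.
rewrite -tr_sylvester ?S_posdef.1//.
have /stable_networkP -> // := erefl (stable_network gamma (fun=> S) M).
by rewrite linearZ /= linearD /= trmxK addrC.
Qed.

(** The equation puts (M + M^T) / 2 on the right of the trace, and the skew part of [M] is
    orthogonal to the symmetric [W]. *)
Lemma trace_mul_stable_network (R : realType) (n : nat) (gamma : 'I_n -> R)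
    (S M W : 'M[R]_n) : (forall i, 0 < gamma i) -> posdef S -> W^T = W ->
  \tr (W *m sylvester gamma S (stable_network gamma (fun=> S) M))
  = \tr (M^T *m W).
Proof.
move=> gamma_gt0 S_posdef W_sym.
have /stable_networkP -> // := erefl (stable_network gamma (fun=> S) M).
rewrite -scalemxAr mxtraceZ mulmxDr mxtraceD.
have -> : \tr (W *m M) = \tr (M^T *m W) by rewrite -mxtrace_tr trmx_mul W_sym.
by rewrite [\tr (W *m M^T)]mxtrace_mulC; field.
Qed.

(** For skew [M] the network is zero; excluding this case is what makes the trace inequalities
    strict. *)
Lemma stable_network_neq0 (R : realType) (n : nat) (gamma : 'I_n -> R)
    (S M : 'M[R]_n) : (forall i, 0 < gamma i) -> posdef S -> M + M^T != 0 ->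
  stable_network gamma (fun=> S) M != 0.
Proof.
move=> gamma_gt0 S_posdef; apply: contra_neq.
move=> /stable_networkP; rewrite linear0 => /(_ gamma_gt0 S_posdef)/esym/eqP.
by rewrite scaler_eq0 invr_eq0 pnatr_eq0 => /eqP.
Qed.

Lemma trace_stable_network_gt0 (R : realType) (n : nat) (gamma : 'I_n -> R)
    (S M : 'M[R]_n) : (forall i, 0 < gamma i) -> posdef S -> M + M^T != 0 ->
  0 < \tr (M^T *m stable_network gamma (fun=> S) M).
Proof.
move=> gamma_gt0 S_posdef M_neq0.
have W_sym := stable_network_sym M gamma_gt0 S_posdef.
rewrite -(trace_mul_stable_network _ gamma_gt0 S_posdef W_sym) -{1}W_sym.
by apply: trace_sylvester_gt0 => //; exact: stable_network_neq0.
Qed.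

(** The entry is tr (E^T W) with E = [delta_mx i j] and W the network for the returns E, so the
    trace inequality applies. *)
Lemma stable_network_delta_gt0 (R : realType) (n : nat) (gamma : 'I_n -> R)
    (S : 'M[R]_n) (i j : 'I_n) : (forall i, 0 < gamma i) -> posdef S ->
  0 < stable_network gamma (fun=> S) (delta_mx i j) i j.
Proof.
move=> gamma_gt0 S_posdef.
set E := delta_mx i j : 'M[R]_n.
have E_neq0 : E + E^T != 0.
  apply/eqP => /matrixP/(_ i j); rewrite !mxE !eqxx /= => /eqP.
  by rewrite gt_eqF// ltr_pwDl.
have := trace_stable_network_gt0 gamma_gt0 S_posdef E_neq0.
rewrite /E trmx_delta -(mul_delta_mx (0 : 'I_1)) -mulmxA mxtrace_mulC.
by rewrite -rowE -colE trace_mx11 !mxE.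
Qed.

(** * Dependence on the covariance *)

Lemma sylvester_scale (R : realType) (n : nat) (gamma : 'I_n -> R)
    (S W : 'M[R]_n) (c : R) :
  sylvester gamma (c *: S) W = c *: sylvester gamma S W.
Proof. by rewrite /sylvester -!(scalemxAl, scalemxAr) scalerDr. Qed.

Lemma sylvesterDl (R : realType) (n : nat) (gamma : 'I_n -> R)
    (S S' W : 'M[R]_n) :
  sylvester gamma (S + S') W = sylvester gamma S W + sylvester gamma S' W.
Proof. by rewrite /sylvester !(mulmxDl, mulmxDr) addrACA. Qed.

(* With <X, Y> := tr (X^T Y), L := sylvester gamma S and L' its analogue for S',
   expanding <L (W' - W), W' - W> >= 0 gives <M, W> >= 2 <M, W'> - <L W', W'>,
   and <L W', W'> < <L' W', W'> = <M, W'>. *)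
Lemma trace_stable_network_lt0 (R : realType) (n : nat) (gamma : 'I_n -> R)
    (S S' M : 'M[R]_n) : (forall i, 0 < gamma i) -> posdef S ->
  posdef (S' - S) -> M + M^T != 0 ->
  \tr (M^T *m (stable_network gamma (fun=> S') M
               - stable_network gamma (fun=> S) M)) < 0.
Proof.
move=> gamma_gt0 S_posdef dS_posdef M_neq0.
have S'_posdef : posdef S'.
  rewrite -(subrK S S'); split=> [|x x_neq0].
    by rewrite linearD /= S_posdef.1 dS_posdef.1.
  by rewrite mulmxDr mulmxDl mxE addr_gt0// ?S_posdef.2// dS_posdef.2.
set W := stable_network _ (fun=> S) _; set W' := stable_network _ _ _.
have W_sym : W^T = W by exact: stable_network_sym.
have W'_sym : W'^T = W' by exact: stable_network_sym.
have W'_neq0 : W' != 0 by exact: stable_network_neq0.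
have := trace_sylvester_gt0 gamma_gt0 dS_posdef W'_neq0.
have : 0 <= \tr ((W' - W)^T *m sylvester gamma S (W' - W)).
  have [->|/(trace_sylvester_gt0 gamma_gt0 S_posdef)/ltW//] := eqVneq (W' - W) 0.
  by rewrite linear0 mul0mx mxtrace0.
have MW' := trace_mul_stable_network M gamma_gt0 S'_posdef W'_sym.
have MW := trace_mul_stable_network M gamma_gt0 S_posdef W_sym.
have MW'W := trace_mul_stable_network M gamma_gt0 S_posdef W'_sym.
have WW' := trace_sylvesterC gamma W W' S_posdef.1.
rewrite -/W -/W' W_sym W'_sym in MW' MW MW'W WW'.
rewrite -{1}[S'](subrK S) sylvesterDl mulmxDr mxtraceD in MW'.
rewrite linearB /= W_sym W'_sym linearB /= mulmxBl !mulmxBr !raddfB /=.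
by rewrite WW' MW MW'W; lra.
Qed.

(** * Diagonalization and the sensitivity formula *)

Lemma sylvester_eigen (R : realType) (n : nat) (A V X B : 'M[R]_n)
    (lambda : 'rV[R]_n) : eigendecomposition A V lambda ->
  (forall s, 0 < lambda 0 s) -> A *m X + X *m A = B ->
  X = V *m (\matrix_(s, t) ((V^T *m B *m V) s t / (lambda 0 s + lambda 0 t)))
      *m V^T.
Proof.
move=> [VV A_eq] lambda_gt0 X_eq; have VV' := mulmx1C VV.
suff -> : \matrix_(s, t) ((V^T *m B *m V) s t / (lambda 0 s + lambda 0 t))
    = V^T *m X *m V by rewrite !mulmxA VV' mul1mx -mulmxA VV' mulmx1.
(* In the eigenbasis the equation decouples into (lambda_s + lambda_t) Y_st = (V^T B V)_st. *)
set Y := V^T *m X *m V.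
have -> : V^T *m B *m V = diag_mx lambda *m Y + Y *m diag_mx lambda.
  rewrite -X_eq A_eq mulmxDr mulmxDl !mulmxA VV mul1mx; congr (_ + _).
  by rewrite -mulmxA VV mulmx1.
apply/matrixP => s t; rewrite mul_diag_mx mul_mx_diag mxE [X in X / _]mxE.
apply: (canLR (mulfK _)); first by rewrite gt_eqF// addr_gt0.
by rewrite [X in X + _]mxE [X in _ + X]mxE mulrDr [lambda _ _ * _]mulrC.
Qed.

(** The eigenvalue lambda_s is the quadratic form of [S] at D v_s, with v_s the s-th column of [V];
    this vector is nonzero because [D] and [V] are invertible. *)
Lemma normalized_cov_eigenvalue_gt0 (R : realType) (n : nat)
    (gamma : 'I_n -> R) (S V : 'M[R]_n) (lambda : 'rV[R]_n) (s : 'I_n) :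
  (forall i, 0 < gamma i) -> posdef S ->
  eigendecomposition (normalized_cov gamma S) V lambda -> 0 < lambda 0 s.
Proof.
move=> gamma_gt0 [_ S_gt0] [VV]; rewrite /normalized_cov.
set D := diag_mx (\row_i (Num.sqrt (gamma i))^-1) => eigen.
have -> : lambda 0 s = ((col s (D *m V))^T *m S *m col s (D *m V)) 0 0.
  rewrite form_col trmx_mul tr_diag_mx.
  have -> : V^T *m D *m S *m (D *m V) = V^T *m (D *m S *m D) *m V.
    by rewrite !mulmxA.
  rewrite eigen !mulmxA VV mul1mx -mulmxA VV mulmx1.
  by rewrite mxE eqxx mulr1n.
apply: S_gt0; apply/eqP => DV0; have /matrixP/(_ s s) := VV.
pose D' : 'M[R]_n := diag_mx (\row_i Num.sqrt (gamma i)).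
have D'D : D' *m D = 1%:M.
  rewrite mulmx_diag; apply/matrixP => a b; rewrite !mxE.
  by rewrite divff // gt_eqF // sqrtr_gt0.
have -> : V^T *m V = V^T *m D' *m (D *m V).
  by rewrite -mulmxA (mulmxA D') D'D mul1mx.
rewrite !mxE eqxx big1 => [/eqP|k _]; first by rewrite eq_sym oner_eq0.
by have /colP/(_ k) := DV0; rewrite [col _ _ _ _]mxE => ->;
  rewrite [X in _ * X]mxE mulr0.
Qed.

(** By linearity the difference quotient is constant for [h] nonzero. *)
Lemma is_derive_stable_network (R : realType) (n : nat) (gamma : 'I_n -> R)
    (S M E : 'M[R]_n) (i j : 'I_n) : (forall i, 0 < gamma i) -> posdef S ->
  is_derive M E (fun N : 'M[R]_n => stable_network gamma (fun=> S) N i j)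
    (stable_network gamma (fun=> S) E i j).
Proof.
move=> gamma_gt0 S_posdef; set f := fun N => _.
have lim_f : ((fun h : R => h^-1 *: ((f \o shift M) (h *: E) - f M)) @ 0^'
    --> f E)%classic.
  apply: cvg_near_cst; near=> h.
  rewrite /= /f stable_network_is_linear// !mxE addrK.
  rewrite /GRing.scale /= mulKf//.
  by near: h; exact: nbhs_dnbhs_neq.
by split; [apply/cvg_ex; exists (f E) | apply/cvg_lim].
Unshelve. all: by end_near. Qed.

Lemma mul_delta_mul (R : realType) (n : nat) (A B : 'M[R]_n) (i j k l : 'I_n) :
  (A *m delta_mx k l *m B) i j = A i k * B l j.
Proof.
rewrite -(mul_delta_mx (0 : 'I_1)) mulmxA -colE -mulmxA -rowE mxE big_ord1.
by rewrite !mxE.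
Qed.

Lemma stable_network_delta (R : realType) (n : nat) (gamma : 'I_n -> R)
    (S V : 'M[R]_n) (lambda : 'rV[R]_n) (i j k l : 'I_n) :
  (forall i, 0 < gamma i) -> posdef S ->
  eigendecomposition (normalized_cov gamma S) V lambda ->
  stable_network gamma (fun=> S) (delta_mx k l) i j =
  (2 * Num.sqrt (gamma i * gamma j * gamma k * gamma l))^-1 *
    \sum_(s < n) \sum_(t < n)
      (V i s * V k s * V j t * V l t + V i s * V l s * V j t * V k t) /
      (lambda 0 s + lambda 0 t).
Proof.
move=> gamma_gt0 S_posdef eigen.
have lambda_gt0 s := normalized_cov_eigenvalue_gt0 s gamma_gt0 S_posdef eigen.
have sqrt_gt0 a : 0 < Num.sqrt (gamma a) by rewrite sqrtr_gt0.
have sqrt_neq0 a : Num.sqrt (gamma a) != 0 by rewrite gt_eqF.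
set E := delta_mx k l; set W := stable_network _ _ _.
have W_eq : sylvester gamma S W = 2^-1 *: (E + E^T) by apply/stable_networkP.
pose D : 'M[R]_n := diag_mx (\row_i (Num.sqrt (gamma i))^-1).
pose D' : 'M[R]_n := diag_mx (\row_i Num.sqrt (gamma i)).
pose G : 'M[R]_n := diag_mx (\row_i gamma i).
have DD' : D *m D' = 1%:M.
  rewrite mulmx_diag; apply/matrixP => a b; rewrite !mxE.
  by rewrite mulVf.
have DG : D *m G = D'.
  rewrite mulmx_diag; congr diag_mx; apply/rowP => a; rewrite !mxE.
  by rewrite -{2}(sqr_sqrtr (ltW (gamma_gt0 a))) expr2 mulKf.
have GD : G *m D = D'.
  by rewrite -DG mulmx_diag mulmx_diag; congr diag_mx; apply/rowP => a;
  rewrite !mxE mulrC.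
have D'D : D' *m D = 1%:M by rewrite mulmx1C.
(* Multiplying the equation for [W] by [D] on both sides gives the Sylvester equation for
   [D' *m W *m D'], to which [sylvester_eigen] applies. *)
have X_eq : normalized_cov gamma S *m (D' *m W *m D')
    + D' *m W *m D' *m normalized_cov gamma S
    = D *m (2^-1 *: (E + E^T)) *m D.
  rewrite -W_eq /sylvester -/G mulmxDr mulmxDl /normalized_cov -/D.
  congr (_ + _).
    by rewrite -!mulmxA GD (mulmxA D D') DD' mul1mx.
  by rewrite !mulmxA DG -(mulmxA _ D' D) D'D mulmx1.
have := sylvester_eigen eigen lambda_gt0 X_eq => /matrixP/(_ i j).
rewrite mul_mx_diag mul_diag_mx [in LHS]mxE [X in X * _]mxE !(mxE _ _ 0) => Xij.
(* Sandwiching a unit matrix gives a product of an entry of row [k] and one of row [l] of [D *m V];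
   [D] contributes the factors 1 / sqrt gamma. *)
have C_eq s t : (V^T *m (D *m (2^-1 *: (E + E^T)) *m D) *m V) s t
    = (2 * Num.sqrt (gamma k) * Num.sqrt (gamma l))^-1
      * (V k s * V l t + V l s * V k t).
  have -> : V^T *m (D *m (2^-1 *: (E + E^T)) *m D) *m V
      = 2^-1 *: (V^T *m D *m E *m (D *m V) + V^T *m D *m E^T *m (D *m V)).
    by rewrite -!(scalemxAl, scalemxAr) !(mulmxDl, mulmxDr) !mulmxA.
  rewrite trmx_delta mxE [X in _ * X]mxE !mul_delta_mul.
  rewrite mul_mx_diag mul_diag_mx !mxE.
  by field; rewrite !sqrt_neq0.
have -> : W i j = (Num.sqrt (gamma i) * W i j * Num.sqrt (gamma j))
    / (Num.sqrt (gamma i) * Num.sqrt (gamma j)).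
  by field; rewrite !sqrt_neq0.
(* Expanding V C V^T puts the sum over [t] outermost, hence the exchange. *)
rewrite Xij mxE [in RHS]exchange_big mulr_suml mulr_sumr.
apply: eq_bigr => t _ /=.
rewrite mxE !mulr_suml mulr_sumr; apply: eq_bigr => s _.
rewrite [V^T _ _]mxE [X in _ * X * _]mxE C_eq !sqrtrM ?mulr_ge0 ?ltW//.
by field; rewrite !sqrt_neq0 gt_eqF// addr_gt0.
Qed.

Theorem theorem7 (R : realType) (n : nat) (gamma : 'I_n -> R)
    (Sigma : 'M[R]_n) (M : 'M[R]_n)
    (gamma_gt0 : forall i, 0 < gamma i) (Sigma_posdef : posdef Sigma) :
  ((forall (V : 'M[R]_n) (lambda : 'rV[R]_n),
      eigendecomposition (normalized_cov gamma Sigma) V lambda ->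
      forall i j k l : 'I_n,
        is_derive M (delta_mx k l)
          (fun N : 'M[R]_n => stable_network gamma (fun=> Sigma) N i j)
          ((2 * Num.sqrt (gamma i * gamma j * gamma k * gamma l))^-1 *
           \sum_(s < n) \sum_(t < n)
             (V i s * V k s * V j t * V l t + V i s * V l s * V j t * V k t) /
             (lambda 0 s + lambda 0 t)))
   /\ (forall (i j : 'I_n) (a b : R), a < b ->
        stable_network gamma (fun=> Sigma) (M + a *: delta_mx i j) i j
        < stable_network gamma (fun=> Sigma) (M + b *: delta_mx i j) i j))
  /\ (forall c : R, 0 < c ->
        stable_network gamma (fun=> c *: Sigma) M =
        c^-1 *: stable_network gamma (fun=> Sigma) M)
  /\ ((forall i j, gamma i = gamma j) -> M + M^T <> 0 ->
      forall Sigma' : 'M[R]_n, posdef (Sigma' - Sigma) ->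
        \tr (M^T *m (stable_network gamma (fun=> Sigma') M
                     - stable_network gamma (fun=> Sigma) M)) < 0).
Proof.
split; [split|split].
- move=> V lambda eigen i j k l.
  rewrite -(stable_network_delta _ _ _ _ gamma_gt0 Sigma_posdef eigen).
  exact: is_derive_stable_network.
(* The entry is affine in the coefficient of [delta_mx i j], with the positive slope of
   [stable_network_delta_gt0]. *)
- move=> i j a b lt_ab; rewrite ![M + _]addrC !stable_network_is_linear// !mxE.
  by rewrite ltrD2r ltr_pM2r// stable_network_delta_gt0.
- move=> c c_gt0.
  have cSigma_posdef : posdef (c *: Sigma).
    split=> [|x x_neq0]; first by rewrite linearZ /= Sigma_posdef.1.
    by rewrite -scalemxAr -scalemxAl mxE mulr_gt0// Sigma_posdef.2.
  (* Scaling the covariance scales the operator by [c], while the right-hand side stays fixed. *)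
  apply/stable_networkP => //; rewrite linearZ /= sylvester_scale scalerA.
  by rewrite mulVf ?gt_eqF// scale1r; apply/stable_networkP.
- by move=> _ MT_neq0 Sigma' dSigma;
  apply: trace_stable_network_lt0 => //; exact/eqP.
Qed.
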